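(* Every pair of orthogonal quantum Latin squares of order $5$ is classical.
   Context: A quantum Latin square (QLS) of order $n$ is an $n\times n$ matrix $\Psi=(\psi_{ij})_{1\le i,j\le n}$ whose entries are unit vectors in $\mathbb C^n$ such that the entries of each row and the entries of each column form an orthonormal basis of $\mathbb C^n$. Two QLS $\Psi=(\psi_{ij})$ and $\Phi=(\phi_{ij})$ of order $n$ are orthogonal if $\{\psi_{ij}\otimes\phi_{ij}: 1\le i,j\le n\}$ is an orthonormal basis of $\mathbb C^n\otimes\mathbb C^n$. Fix the standard orthonormal basis $\ket{1},\dots,\ket{n}$ of $\mathbb C^n$. Two pairs of orthogonal QLS of order $n$ are isotopic if one can be obtained from the other by a sequence of the operations: (i) multiplying individual entries by phase factors; (ii) permuting the rows, and permuting the columns, simultaneously in both squares; (iii) for each square separately, applying one unitary transformation of $\mathbb C^n$ to all entries of that square. A pair is classical if it is isotopic to a pair all of whose entries lie in $\{\ket{1},\dots,\ket{n}\}$. *)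

(* Defs.v *)
(* complex numbers C = R[i] over a realType R
   (mathcomp-real-closed's complex), vectors of C^n as row vectors 'rV[C]_n. *)
From HB Require Import structures.
From mathcomp Require Import all_boot all_order all_algebra all_fingroup.
From mathcomp Require Import reals.
From mathcomp Require Import complex.
From Stdlib Require Import Relations.
Set Implicit Arguments. Unset Strict Implicit. Unset Printing Implicit Defensive.
Import Order.TTheory GRing.Theory Num.Theory.
Local Open Scope ring_scope.
Local Open Scope complex_scope.

Section QLS.
Variable R : realType.
Local Notation C := R[i].

(* Hermitian inner product <u|v> = sum_k conj(u_k) v_k *)
Definition cdot (m : nat) (u v : 'rV[C]_m) : C :=
  \sum_(k < m) (u 0 k)^* * v 0 k.

(* an indexed family f : I -> C^m is an orthonormal basis of C^m:
   orthonormal and spanning *)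
Definition onbasis (I : finType) (m : nat) (f : I -> 'rV[C]_m) : Prop :=
  (forall a b, cdot (f a) (f b) = (a == b)%:R) /\
  (forall v : 'rV[C]_m, exists c : I -> C, v = \sum_(a : I) c a *: f a).

(* a square of order n: n x n array of vectors of C^n *)
Definition square (n : nat) := 'I_n -> 'I_n -> 'rV[C]_n.

(* quantum Latin square (entries are automatically unit vectors,
   being members of orthonormal bases) *)
Definition is_QLS (n : nat) (P : square n) : Prop :=
  (forall i, onbasis (fun j => P i j)) /\ (forall j, onbasis (fun i => P i j)).

(* tensor product C^n (x) C^n = C^(n*n), coordinates indexed via mxvec *)
Definition tensor (n : nat) (u v : 'rV[C]_n) : 'rV[C]_(n * n) :=
  mxvec (u^T *m v).

Definition orthogonal_QLS (n : nat) (P Q : square n) : Prop :=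
  is_QLS P /\ is_QLS Q /\
  onbasis (fun ij : 'I_n * 'I_n => tensor (P ij.1 ij.2) (Q ij.1 ij.2)).

Definition unitary (n : nat) (U : 'M[C]_n) : Prop :=
  U *m (map_mx (fun z : C => z^*) U)^T = 1%:M.

(* one elementary isotopy operation on a pair of squares *)
Inductive iso_step (n : nat) : square n * square n -> square n * square n -> Prop :=
  | iso_phase (P Q : square n) (c d : 'I_n -> 'I_n -> C) :
      (forall i j, `|c i j| = 1) -> (forall i j, `|d i j| = 1) ->
      iso_step (P, Q) (fun i j => c i j *: P i j, fun i j => d i j *: Q i j)
  | iso_perm (P Q : square n) (s t : 'S_n) :
      iso_step (P, Q) (fun i j => P (s i) (t j), fun i j => Q (s i) (t j))
  | iso_unitary (P Q : square n) (U V : 'M[C]_n) :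
      unitary U -> unitary V ->
      iso_step (P, Q) (fun i j => P i j *m U, fun i j => Q i j *m V).

(* isotopy: obtainable by a finite sequence of elementary operations *)
Definition isotopic (n : nat) (PQ PQ' : square n * square n) : Prop :=
  clos_refl_trans _ (@iso_step n) PQ PQ'.

(* standard basis vector |k> *)
Definition std_vec (n : nat) (k : 'I_n) : 'rV[C]_n := delta_mx 0 k.

Definition classical_pair (n : nat) (P Q : square n) : Prop :=
  exists P' Q' : square n,
    isotopic (P, Q) (P', Q') /\
    (forall i j, exists k, P' i j = std_vec k) /\
    (forall i j, exists k, Q' i j = std_vec k).

End QLS.

(* Main.v *)
(** Write [weight u v] for the square modulus of the inner product of [u] and [v].
    Two distinct cells are orthogonal in [P] or in [Q], so for two fixed rows the
    matrices of weights of [P] and of [Q] are doubly stochastic, have zero diagonals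
    and disjoint supports; a mass count shows that each of their rows has at most two
    nonzero entries.  Suppose that some weight of [P] lies strictly between 0 and 1.
    The two cells then span a plane, and each row and each column has exactly two
    entries in this plane, all the others being orthogonal to it.  Following these
    entries along rows and columns yields a 2x2 block of entries in the plane, each of
    them non-orthogonal to two further entries of a common row outside the block.  In
    [Q] the block is orthonormal, and each of its four vectors has mass 2 on the nine
    cells which share no row or column with the block, seven of which can carry mass:
    8 <= 7.  Hence all weights are 0 or 1, every entry of [P] is a phase times an entry
    of its first row, and by symmetry the same holds for [Q]. *)

Require Import Defs.
From HB Require Import structures.
From mathcomp Require Import all_boot all_order all_algebra all_fingroup.
From mathcomp Require Import reals complex.
From mathcomp Require Import ring lra.
From Stdlib Require Import Relations.

Set Implicit Arguments. Unset Strict Implicit. Unset Printing Implicit Defensive.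
Import Order.TTheory GRing.Theory Num.Theory.
Local Open Scope ring_scope.

(** * Inner products, weights, Parseval and Bessel *)

Section InnerProduct.
Variable R : realType.
Local Notation C := R[i]%C.
Implicit Types (z : C).

(** Real-valued, so that sums of weights fall under linear arithmetic over [R]. *)
Definition sqnorm z : R := complex.Re (`|z| ^+ 2).

Lemma sqnormE z : (sqnorm z)%:C%C = `|z| ^+ 2.
Proof. by rewrite /sqnorm RRe_real // ger0_real // exprn_ge0. Qed.

Lemma sqnorm_ge0 z : 0 <= sqnorm z.
Proof. by rewrite -ler0c sqnormE exprn_ge0. Qed.

Lemma sqnorm_eq0 z : (sqnorm z == 0) = (z == 0).
Proof. by rewrite -(inj_eq (@complexI R)) sqnormE expf_eq0 normr_eq0. Qed.

Lemma sqnorm0 : sqnorm 0 = 0.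
Proof. by apply/eqP; rewrite sqnorm_eq0. Qed.

Lemma sqnorm1 : sqnorm 1 = 1.
Proof. by apply: (@complexI R); rewrite sqnormE normr1 expr1n. Qed.

Lemma sqnorm_conj z : sqnorm z^* = sqnorm z.
Proof. by apply: (@complexI R); rewrite !sqnormE norm_conjC. Qed.

Section Cdot.
Variable n : nat.
Implicit Types (u v : 'rV[C]_n).

Lemma cdotC u v : cdot v u = (cdot u v)^*.
Proof.
by rewrite /cdot rmorph_sum; apply: eq_bigr => k _; rewrite rmorphM /= conjCK mulrC.
Qed.

Lemma cdotDr u v v' : cdot u (v + v') = cdot u v + cdot u v'.
Proof. by rewrite -big_split; apply: eq_bigr => k _; rewrite mxE mulrDr. Qed.

Lemma cdotZr c u v : cdot u (c *: v) = c * cdot u v.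
Proof. by rewrite /cdot mulr_sumr; apply: eq_bigr => k _; rewrite mxE mulrCA. Qed.

Lemma cdotZl c u v : cdot (c *: u) v = c^* * cdot u v.
Proof. by rewrite cdotC cdotZr rmorphM /= -cdotC. Qed.

Lemma cdotDl u u' v : cdot (u + u') v = cdot u v + cdot u' v.
Proof. by rewrite cdotC cdotDr rmorphD /= -!cdotC. Qed.

Lemma cdot_sumr (I : finType) u (F : I -> 'rV[C]_n) :
  cdot u (\sum_i F i) = \sum_i cdot u (F i).
Proof.
apply: (big_morph (cdot u) (cdotDr u)).
by rewrite /cdot big1 // => k _; rewrite mxE mulr0.
Qed.

Lemma cdot_ge0 u : 0 <= cdot u u.
Proof. by apply: sumr_ge0 => k _; rewrite mulrC -normCK exprn_ge0. Qed.

Definition weight u v : R := sqnorm (cdot u v).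

Lemma weight_ge0 u v : 0 <= weight u v. Proof. exact: sqnorm_ge0. Qed.

Lemma weightC u v : weight u v = weight v u.
Proof. by rewrite /weight cdotC sqnorm_conj. Qed.

Lemma weight_eq0 u v : (weight u v == 0) = (cdot u v == 0).
Proof. exact: sqnorm_eq0. Qed.

Lemma weight_self u : cdot u u = 1 -> weight u u = 1.
Proof. by rewrite /weight => ->; rewrite sqnorm1. Qed.

Lemma weightE u v : (weight u v)%:C%C = cdot v u * cdot u v.
Proof. by rewrite sqnormE normCK mulrC -cdotC. Qed.

Lemma onbasis_expand (I : finType) (f : I -> 'rV[C]_n) v :
  onbasis f -> v = \sum_i cdot (f i) v *: f i.
Proof.
move=> [on /(_ v) [c ->]]; apply: eq_bigr => i _; congr (_ *: _).
rewrite cdot_sumr (bigD1 i) //= cdotZr on eqxx mulr1 big1 ?addr0 // => j ji.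
by rewrite cdotZr on eq_sym (negPf ji) mulr0.
Qed.

Lemma parseval (I : finType) (f : I -> 'rV[C]_n) u v :
  onbasis f -> cdot u v = \sum_i cdot u (f i) * cdot (f i) v.
Proof.
move=> fb; rewrite {1}(onbasis_expand v fb) cdot_sumr.
by apply: eq_bigr => i _; rewrite cdotZr mulrC.
Qed.

Lemma weight_sum (I : finType) (f : I -> 'rV[C]_n) v :
  onbasis f -> cdot v v = 1 -> \sum_i weight v (f i) = 1.
Proof.
move=> fb v1; apply: (@complexI R); rewrite rmorph_sum rmorph1 -v1.
rewrite (parseval v v fb); apply: eq_bigr => i _.
by rewrite -[LHS]/((weight v (f i))%:C%C) weightE mulrC.
Qed.

(** Induction on [s]: removing from [v] its component along the head lowers [cdot v v] by one weight
    and leaves the weights of the tail unchanged. The remainder is in general no unit vector, whence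
    the arbitrary [v]. *)
Lemma bessel_gen (s : seq 'rV[C]_n) v :
  {in s, forall u, cdot u u = 1} -> pairwise (fun u u' => cdot u u' == 0) s ->
  (\sum_(u <- s) weight u v)%:C%C <= cdot v v.
Proof.
elim: s v => [|u s IHs] v; first by rewrite big_nil rmorph0 cdot_ge0.
move=> nrm /= /andP[/allP us ps].
have u1 : cdot u u = 1 by rewrite nrm ?mem_head.
pose v' := v + (- cdot u v) *: u.
have Ev : cdot v v = (weight u v)%:C%C + cdot v' v'.
  rewrite weightE /v' !(cdotDl, cdotDr, cdotZl, cdotZr) u1 rmorphN /= -cdotC; ring.
have Es : \sum_(x <- s) weight x v' = \sum_(x <- s) weight x v.
  rewrite !big_seq; apply: eq_bigr => x xs; rewrite /weight cdotDr cdotZr.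
  by rewrite (cdotC u x) (eqP (us x xs)) conjC0 mulr0 addr0.
rewrite big_cons rmorphD /= Ev lerD2l -Es; apply: IHs => // x xs.
by rewrite nrm // inE xs orbT.
Qed.

Lemma bessel (s : seq 'rV[C]_n) v :
  cdot v v = 1 -> {in s, forall u, cdot u u = 1} ->
  pairwise (fun u u' => cdot u u' == 0) s -> \sum_(u <- s) weight u v <= 1.
Proof. by move=> v1 s1 s0; rewrite -(@lecR R) rmorph1 -v1 bessel_gen. Qed.

End Cdot.

Lemma cdot_tensor n (u v u' v' : 'rV[C]_n) :
  cdot (tensor u v) (tensor u' v') = cdot u u' * cdot v v'.
Proof.
rewrite /cdot big_distrlr /= pair_bigA /=.
rewrite (reindex (uncurry (@mxvec_index n n))) /=; last first.
  by have [g] := curry_mxvec_bij n n; exists g.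
apply: eq_bigr => -[i j] _ /=; rewrite !mxvecE !mxE !big_ord1 !mxE rmorphM /=.
by rewrite mulrACA.
Qed.

End InnerProduct.

(** * Enumerations of a finite index set *)

Lemma ord_fresh n (s : seq 'I_n) : (size s < n)%N -> exists t, t \notin s.
Proof.
move=> lt_sn; have [/forallP s_all | ] := boolP [forall t, t \in s].
  have := uniq_leq_size (enum_uniq 'I_n) (fun t _ => s_all t).
  by rewrite -cardE card_ord leqNgt lt_sn.
by rewrite negb_forall => /existsP.
Qed.

Lemma perm_index_enum n (s : seq 'I_n) :
  uniq s -> size s = n -> perm_eq (index_enum 'I_n) s.
Proof.
move=> Us sz; rewrite perm_sym; apply: uniq_perm => //; first exact: index_enum_uniq.
have szE : (size (index_enum 'I_n) <= size s)%N.
  by rewrite sz -[X in (_ <= X)%N](card_ord n) cardT enumT.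
by have [] := uniq_min_size Us (fun t _ => mem_index_enum t) szE.
Qed.

(** * Supports of disjoint weight matrices of order 5 *)

Section SupportOfUnitaries.
Variable R : realDomainType.

Lemma sum5 (f : 'I_5 -> R) r p q s t : uniq [:: r; p; q; s; t] ->
  \sum_k f k = f r + f p + f q + f s + f t.
Proof.
move=> U; rewrite (perm_big _ (perm_index_enum U (erefl _))) /=.
by rewrite !big_cons big_nil addr0 !addrA.
Qed.

Lemma ord5_cases (r p q s t k : 'I_5) : uniq [:: r; p; q; s; t] ->
  [\/ k = r, k = p, k = q | k = s \/ k = t].
Proof.
move=> U; have := perm_mem (perm_index_enum U (erefl _)) k.
rewrite mem_index_enum !inE => /esym.
by case/or4P => [|||/orP[]] /eqP; auto using Or41, Or42, Or43, Or44.
Qed.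

(* [x] and [y] are the entrywise square moduli of two unitary matrices of
   order 5 with zero diagonals and disjoint supports; orthogonality of the rows
   of the first one is only used through [quad]. *)
Variables x y : 'I_5 -> 'I_5 -> R.
Hypotheses (x_ge0 : forall j k, 0 <= x j k) (y_ge0 : forall j k, 0 <= y j k).
Hypotheses (x_row : forall j, \sum_k x j k = 1) (x_col : forall k, \sum_j x j k = 1).
Hypotheses (y_row : forall j, \sum_k y j k = 1) (y_col : forall k, \sum_j y j k = 1).
Hypotheses (x_diag : forall j, x j j = 0) (y_diag : forall j, y j j = 0).
Hypothesis xy0 : forall j k, x j k = 0 \/ y j k = 0.
Hypothesis quad : forall j j' k, j != j' -> 0 < x j k -> 0 < x j' k ->
  exists2 k', k' != k & 0 < x j k' /\ 0 < x j' k'.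

Lemma y0_of_x_gt0 j k : 0 < x j k -> y j k = 0.
Proof. by case: (xy0 j k) => // ->; rewrite ltxx. Qed.

Lemma x0_of_y1 j k : y j k = 1 -> x j k = 0.
Proof. by case: (xy0 j k) => // -> /eqP; rewrite eq_sym oner_eq0. Qed.

(** Row [r] of [y] has three zeros by disjointness and one on the diagonal, so its whole mass sits
    at [t] and exhausts column [t]. *)
Lemma full_row_spread r p q s t : uniq [:: r; p; q; s; t] ->
    0 < x r p -> 0 < x r q -> 0 < x r s ->
  [/\ y r t = 1, x r t = 0, y p t = 0, y q t = 0 & y s t = 0].
Proof.
move=> U xp xq xs.
have yt : y r t = 1.
  have := y_row r; rewrite (sum5 _ U) y_diag (y0_of_x_gt0 xp).
  by rewrite (y0_of_x_gt0 xq) (y0_of_x_gt0 xs) !add0r.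
have := y_col t; rewrite (sum5 _ U) yt y_diag.
have := y_ge0 p t; have := y_ge0 q t; have := y_ge0 s t.
by split; first [exact: yt | exact: x0_of_y1 | lra].
Qed.

(** Row [p] is active: it meets column [q] or [s]. By [quad] it shares a second column with row [r],
    and with the diagonal zero only the other of [q], [s] is possible. Row [p] of [y] then has only
    column [r] left. *)
Lemma full_row_active r p q s t : uniq [:: r; p; q; s; t] ->
    0 < x r p -> 0 < x r q -> 0 < x r s -> 0 < x p q + x p s ->
  [/\ 0 < x p q, 0 < x p s & y p r = 1].
Proof.
move=> U xp xq xs act.
have [_ xt0 ypt _ _] := full_row_spread U xp xq xs.
have rp : r != p by move: U => /=; rewrite inE; case: eqP.
have [pq ps] : 0 < x p q /\ 0 < x p s.
  have [q0|q0] := eqVneq (x p q) 0.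
    have ps : 0 < x p s by lra.
    have [k ks [rk pk]] := quad rp xs ps.
    case: (ord5_cases k U) rk pk ks => [->|->|->|[]->]; rewrite ?x_diag ?xt0 ?eqxx ?q0 ?ltxx //.
  have pq : 0 < x p q by rewrite lt_def q0 x_ge0.
  split=> //; have [k kq [rk pk]] := quad rp xq pq.
  by case: (ord5_cases k U) rk pk kq => [->|->|->|[]->]; rewrite ?x_diag ?xt0 ?eqxx ?ltxx.
split=> //; have := y_row p.
by rewrite (sum5 _ U) y_diag ypt (y0_of_x_gt0 pq) (y0_of_x_gt0 ps) !addr0.
Qed.

(** Columns [p], [q], [s] hold mass 3, supplied by rows [r], [p], [t] alone, so each of these has
    all its mass there. By [quad], row [t] is then positive on all three columns, and
    [y p r = y t r = 1] overloads column [r]. *)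
Lemma one_active_row r p q s t : uniq [:: r; p; q; s; t] ->
    0 < x r p -> 0 < x r q -> 0 < x r s ->
  x q p = 0 -> x q s = 0 -> x s p = 0 -> x s q = 0 -> False.
Proof.
move=> U xp xq xs qp qs sp sq.
have [yt xt0 _ _ _] := full_row_spread U xp xq xs.
have cp := x_col p; have cq := x_col q; have cs := x_col s.
have rr := x_row r; have rp := x_row p; have rt := x_row t.
rewrite !(sum5 _ U) !x_diag ?qp ?qs ?sp ?sq ?xt0 in cp cq cs rr rp rt.
have := x_ge0 p r; have := x_ge0 p t; have := x_ge0 t r.
have := x_ge0 t p; have := x_ge0 t q; have := x_ge0 t s => *.
have act : 0 < x p q + x p s by lra.
have [pq ps ypr] := full_row_active U xp xq xs act.
have pr0 : x p r = 0 by lra.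
have pt0 : x p t = 0 by lra.
have tp : 0 < x t p by lra.
have pt : p != t by move: U => /= /and3P[_ + _]; rewrite !inE !negb_or => /and3P[].
have [tq ts] : 0 < x t q /\ 0 < x t s.
  have [q0|q0] := eqVneq (x t q) 0.
    have ts : 0 < x t s by lra.
    have [k ks [pk tk]] := quad pt ps ts.
    by case: (ord5_cases k U) pk tk ks => [->|->|->|[]->]; rewrite ?x_diag ?pr0 ?pt0 ?eqxx ?q0 ?ltxx.
  have tq : 0 < x t q by rewrite lt_def q0 x_ge0.
  split=> //; have [k kq [pk tk]] := quad pt pq tq.
  by case: (ord5_cases k U) pk tk kq => [->|->|->|[]->]; rewrite ?x_diag ?pr0 ?pt0 ?eqxx ?ltxx.
have := y_row t; rewrite (sum5 _ U) y_diag.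
rewrite (y0_of_x_gt0 tp) (y0_of_x_gt0 tq) (y0_of_x_gt0 ts).
have := y_col r; rewrite (sum5 _ U) y_diag ypr.
have := y_ge0 q r; have := y_ge0 s r; have := y_ge0 t r; lra.
Qed.

Lemma support_le2 r p q s : uniq [:: p; q; s] ->
  [\/ x r p = 0, x r q = 0 | x r s = 0].
Proof.
move=> U3.
have [xp|xp] := eqVneq (x r p) 0; first exact: Or31.
have [xq|xq] := eqVneq (x r q) 0; first exact: Or32.
have [xs|xs] := eqVneq (x r s) 0; first exact: Or33.
exfalso.
have [t] : exists t, t \notin [:: r; p; q; s] by apply: ord_fresh.
rewrite !inE !negb_or => /and4P[tr tp tq ts].
have [rp rq rs] : [/\ r != p, r != q & r != s].
  by split; [move: xp|move: xq|move: xs]; apply: contraNneq => <-; rewrite x_diag.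
move: U3 => /=; rewrite !inE !negb_or => /andP[/andP[pq ps] /andP[qs _]].
rewrite eq_sym in tr; rewrite eq_sym in tp; rewrite eq_sym in tq; rewrite eq_sym in ts.
have U : uniq [:: r; p; q; s; t].
  by rewrite /= !inE !negb_or rp rq rs tr pq ps tp qs tq ts.
have U' : uniq [:: r; q; p; s; t].
  by rewrite /= !inE !negb_or rp rq rs tr (eq_sym q) pq ps tp qs tq ts.
have U'' : uniq [:: r; s; p; q; t].
  by rewrite /= !inE !negb_or rp rq rs tr !(eq_sym s) pq ps tp qs tq eq_sym ts.
have {}xp : 0 < x r p by rewrite lt_def xp x_ge0.
have {}xq : 0 < x r q by rewrite lt_def xq x_ge0.
have {}xs : 0 < x r s by rewrite lt_def xs x_ge0.
have g := x_ge0.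
have cr := y_col r; rewrite (sum5 _ U) in cr.
have := y_ge0 p r; have := y_ge0 q r; have := y_ge0 s r; have := y_ge0 t r => *.
have := (y_diag r) => *.
(* Each active row among [p], [q], [s] puts mass 1 into column [r] of [y], so at most one is active;
   the two others have the zeros that [one_active_row] asks for. *)
have [ap|ap] := ltP 0 (x p q + x p s).
  have [_ _ yp] := full_row_active U xp xq xs ap.
  have [aq|aq] := ltP 0 (x q p + x q s).
    have [_ _ yq] := full_row_active U' xq xp xs aq; lra.
  have [as_|as_] := ltP 0 (x s p + x s q).
    have [_ _ ys] := full_row_active U'' xs xp xq as_; lra.
  have := g q p; have := g q s; have := g s p; have := g s q => *.
  by apply: (one_active_row U) => //; lra.
have := g p q; have := g p s => *.
have [aq|aq] := ltP 0 (x q p + x q s).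
  have [_ _ yq] := full_row_active U' xq xp xs aq.
  have [as_|as_] := ltP 0 (x s p + x s q).
    have [_ _ ys] := full_row_active U'' xs xp xq as_; lra.
  have := g s p; have := g s q => *.
  by apply: (one_active_row U') => //; lra.
have := g q p; have := g q s => *.
by apply: (one_active_row U'') => //; lra.
Qed.

End SupportOfUnitaries.

(** * Planes and sparse vectors *)

Section Planes.
Variables (R : realType) (n : nat).
Implicit Types (u v c d e : 'rV[R[i]%C]_n).

Lemma weight_pair_le1 u c d : cdot u u = 1 -> cdot c c = 1 -> cdot d d = 1 ->
  cdot c d = 0 -> weight u c + weight u d <= 1.
Proof.
move=> u1 c1 d1 cd; have := @bessel R n [:: c; d] u u1.
rewrite !big_cons big_nil addr0 !(weightC _ u); apply.
  by move=> w; rewrite !inE => /orP[] /eqP ->.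
by rewrite /= cd eqxx.
Qed.

Lemma weight_triple_le1 u c d e :
    cdot u u = 1 -> cdot c c = 1 -> cdot d d = 1 -> cdot e e = 1 ->
    cdot c d = 0 -> cdot c e = 0 -> cdot d e = 0 ->
  weight u c + weight u d + weight u e <= 1.
Proof.
move=> u1 c1 d1 e1 cd ce de; have := @bessel R n [:: c; d; e] u u1.
rewrite !big_cons big_nil addr0 !(weightC _ u) addrA; apply.
  by move=> w; rewrite !inE => /or3P[] /eqP ->.
by rewrite /= cd ce de eqxx.
Qed.

Lemma weight_quadruple_le1 u c d e f :
    cdot u u = 1 -> cdot c c = 1 -> cdot d d = 1 -> cdot e e = 1 -> cdot f f = 1 ->
    cdot c d = 0 -> cdot c e = 0 -> cdot c f = 0 ->
    cdot d e = 0 -> cdot d f = 0 -> cdot e f = 0 ->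
  weight c u + weight d u + weight e u + weight f u <= 1.
Proof.
move=> u1 c1 d1 e1 f1 cd ce cf de df ef; have := @bessel R n [:: c; d; e; f] u u1.
rewrite !big_cons big_nil addr0 !addrA; apply.
  by move=> w; rewrite !inE => /or4P[] /eqP ->.
by rewrite /= cd ce cf de df ef eqxx.
Qed.

Section Plane.
Variables u u' : 'rV[R[i]%C]_n.
Hypotheses (u1 : cdot u u = 1) (u'1 : cdot u' u' = 1).

(* For orthonormal [u], [u'] and a unit vector [c]: [c] lies in their span. *)
Definition in_plane c := weight u c + weight u' c = 1.

(** By Bessel [u] and [u'] each have mass at most 1 on [c] and [d], while the total is 2. *)
Lemma in_plane_orthogonal c d : cdot c c = 1 -> cdot d d = 1 ->
  in_plane c -> in_plane d -> cdot c d = 0 -> weight u c + weight u d = 1.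
Proof.
rewrite /in_plane => c1 d1 cW dW cd.
have := weight_pair_le1 u1 c1 d1 cd; have := weight_pair_le1 u'1 c1 d1 cd; lra.
Qed.

(** Otherwise three orthonormal vectors of the plane would have total mass 3 against [u] and [u'],
    where Bessel allows 2. *)
Lemma in_plane_triple c d e : cdot c c = 1 -> cdot d d = 1 -> cdot e e = 1 ->
  in_plane c -> in_plane d -> in_plane e ->
  cdot c e = 0 -> cdot d e = 0 -> cdot c d != 0.
Proof.
rewrite /in_plane => c1 d1 e1 cW dW eW ce de; apply/eqP => cd.
have := weight_triple_le1 u1 c1 d1 e1 cd ce de.
have := weight_triple_le1 u'1 c1 d1 e1 cd ce de; lra.
Qed.

End Plane.

(** At most two weights are nonzero, put in terms of triples to match [support_le2]. *)
Definition sparse (f : 'I_n -> 'rV[R[i]%C]_n) v := forall p q s, uniq [:: p; q; s] ->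
  [\/ weight v (f p) = 0, weight v (f q) = 0 | weight v (f s) = 0].

Lemma sum_two_terms (V : zmodType) (F : 'I_n -> V) j k : j != k ->
  (forall l, l != j -> l != k -> F l = 0) -> \sum_l F l = F j + F k.
Proof.
move=> jk F0; rewrite (bigD1 j) //= (bigD1 k) 1?eq_sym //= big1 ?addr0 //.
by move=> l /andP[]; apply: F0.
Qed.

Lemma sum_other_term (F : 'I_n -> R) j :
  \sum_l F l != F j -> exists2 k, k != j & F k != 0.
Proof.
move=> sF; have [/existsP[k /andP[kj Fk]]|] := boolP [exists k, (k != j) && (F k != 0)].
  by exists k.
rewrite negb_exists => /forallP F0; case/eqP: sF.
rewrite (bigD1 j) //= big1 ?addr0 // => k kj.
by have := F0 k; rewrite kj negbK => /eqP.
Qed.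

(** A weight below 1 leaves mass for a second basis vector, and sparsity excludes a third. *)
Lemma sparse_two_terms f v j : onbasis f -> cdot v v = 1 -> sparse f v ->
    0 < weight v (f j) -> weight v (f j) < 1 ->
  exists2 k, k != j &
    cdot (f k) v != 0 /\ v = cdot (f j) v *: f j + cdot (f k) v *: f k.
Proof.
move=> fb v1 sv w0 w1.
have [k kj vk] : exists2 k, k != j & weight v (f k) != 0.
  by apply: sum_other_term; rewrite weight_sum // gt_eqF.
exists k => //; split; first by rewrite -weight_eq0 weightC.
rewrite {1}(onbasis_expand v fb); apply: sum_two_terms; first by rewrite eq_sym.
move=> l lj lk; suff /eqP : weight v (f l) = 0.
  by rewrite weightC weight_eq0 => /eqP ->; rewrite scale0r.
have U : uniq [:: j; k; l] by rewrite /= !inE !negb_or eq_sym kj eq_sym lj eq_sym lk.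
have [vj|/eqP|//] := sv _ _ _ U; first by rewrite vj ltxx in w0.
by rewrite (negPf vk).
Qed.

(* Four pairwise non-parallel vectors of a plane, each meeting at most two
   vectors of the basis [f]: among three basis vectors, one is orthogonal to two
   of the four, hence to the plane. *)
Lemma plane_line f u u' v v' (al be ga de : R[i]%C) :
    onbasis f -> cdot u u = 1 -> cdot u' u' = 1 -> cdot u u' = 0 ->
    v = al *: u + be *: u' -> u = ga *: v + de *: v' ->
    al != 0 -> be != 0 -> ga != 0 -> de != 0 -> ga * al != 1 ->
    sparse f u -> sparse f u' -> sparse f v -> sparse f v' ->
  forall j, weight u (f j) + weight u' (f j) != 0 ->
  in_plane u u' (f j) /\ exists2 k, k != j & in_plane u u' (f k).
Proof.
move=> fb u1 u'1 uu' Ev Eu al0 be0 ga0 de0 gaal su su' sv sv' j wj.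
pose om k := weight u (f k) + weight u' (f k).
have f1 k : cdot (f k) (f k) = 1 by rewrite fb.1 eqxx.
have om_le1 k : om k <= 1.
  by rewrite /om !(weightC _ (f k)); apply: weight_pair_le1.
have om_sum : \sum_k om k = 2 by rewrite big_split /= !weight_sum.
(* Any two zeros force the others. For the pair [u'], [v'] the relations give
   [cdot (f k) u = ga * al * cdot (f k) u], where [ga * al != 1] enters. *)
have z2 k : (1 < (weight u (f k) == 0%R) + (weight u' (f k) == 0%R)
    + (weight v (f k) == 0%R) + (weight v' (f k) == 0%R))%N -> om k = 0.
  rewrite !(weightC _ (f k)) !weight_eq0 => z.
  suff [su0 su'0] : cdot (f k) u = 0 /\ cdot (f k) u' = 0.
    by rewrite /om !(weightC _ (f k)) /weight su0 su'0 sqnorm0 addr0.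
  have eV : cdot (f k) v = al * cdot (f k) u + be * cdot (f k) u'.
    by rewrite {1}Ev cdotDr !cdotZr.
  have eU : cdot (f k) u = ga * cdot (f k) v + de * cdot (f k) v'.
    by rewrite {1}Eu cdotDr !cdotZr.
  move: (cdot (f k) u) (cdot (f k) u') (cdot (f k) v) (cdot (f k) v') eV eU z.
  move=> a b c d eV eU.
  have [a0|a0] := eqVneq a 0; have [b0|b0] := eqVneq b 0 => //=.
  - have [c0|c0] := eqVneq c 0.
      by move: eV => /esym/eqP; rewrite a0 c0 mulr0 add0r mulf_eq0 (negPf be0) => /eqP.
    have [d0|//] := eqVneq d 0.
    by move: eU => /esym/eqP; rewrite a0 d0 mulr0 addr0 mulf_eq0 (negPf ga0) (negPf c0).
  - have [c0|c0] := eqVneq c 0.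
      by move: eV => /esym/eqP; rewrite b0 c0 mulr0 addr0 mulf_eq0 (negPf al0) (negPf a0).
    have [d0|//] := eqVneq d 0.
    move: eU => /eqP; rewrite d0 eV b0 !mulr0 !addr0 mulrA -subr_eq0 -{1}[a]mul1r -mulrBl.
    by rewrite mulf_eq0 (negPf a0) orbF subr_eq0 eq_sym (negPf gaal).
  - have [c0|c0] := eqVneq c 0; have [d0|d0] := eqVneq d 0 => //=.
    by move: eU a0; rewrite c0 d0 !mulr0 addr0 => ->; rewrite eqxx.
have om3 p q s : uniq [:: p; q; s] -> [\/ om p = 0, om q = 0 | om s = 0].
  move=> U; pose N k := ((weight u (f k) == 0%R) + (weight u' (f k) == 0%R)
    + (weight v (f k) == 0%R) + (weight v' (f k) == 0%R))%N.
  have cnt w : sparse f w ->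
      (0 < (weight w (f p) == 0%R) + (weight w (f q) == 0%R) + (weight w (f s) == 0%R))%N.
    by move=> /(_ _ _ _ U) [] ->; rewrite eqxx ?addnA ?addn_gt0 ?orbT.
  have {cnt} : (3 < N p + N q + N s)%N.
    apply: leq_trans (leq_add (leq_add (leq_add (cnt u su) (cnt u' su')) (cnt v sv)) (cnt v' sv')) _.
    by rewrite /N; apply: eq_leq; ring.
  case: (ltnP 1 (N p)) => [/z2 ->|Np]; first by constructor 1.
  case: (ltnP 1 (N q)) => [/z2 ->|Nq]; first by constructor 2.
  by case: (ltnP 1 (N s)) => [/z2 ->|Ns]; [constructor 3 | rewrite ltnNge (leq_add (leq_add Np Nq) Ns)].
(* The total mass is 2 and each [om] is at most 1, so [j] has a partner; [om3] excludes a third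
   index, so both masses are 1. *)
have [k kj omk] : exists2 k, k != j & om k != 0.
  apply: sum_other_term; rewrite om_sum; apply/eqP => e2.
  by have := om_le1 j; rewrite -e2; lra.
have om2 : om j + om k = 2.
  rewrite -om_sum; apply/esym/sum_two_terms; first by rewrite eq_sym.
  move=> l lj lk.
  have U : uniq [:: j; k; l] by rewrite /= !inE !negb_or eq_sym kj eq_sym lj eq_sym lk.
  have [/eqP|/eqP|//] := om3 _ _ _ U; first by rewrite (negPf wj).
  by rewrite (negPf omk).
have := om_le1 j; have := om_le1 k => hk hj.
split; first by rewrite /in_plane -/(om j); lra.
by exists k => //; rewrite /in_plane -/(om k); lra.
Qed.

End Planes.

(** * Pairs of squares with disjoint overlaps *)

Section DisjointPairs.
Variable R : realType.

(** The form in which orthogonality is used: inner products of tensors factorise, so for distinct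
    cells one factor vanishes. It is stable under swapping the squares and under transposition. *)
Definition disjoint_QLS n (P Q : square R n) :=
  [/\ is_QLS P, is_QLS Q & forall i j k l, (i, j) != (k, l) ->
    cdot (P i j) (P k l) = 0 \/ cdot (Q i j) (Q k l) = 0].

Definition transpose n (P : square R n) : square R n := fun i j => P j i.

Lemma orthogonal_disjoint n (P Q : square R n) :
  orthogonal_QLS P Q -> disjoint_QLS P Q.
Proof.
move=> [qP [qQ [on _]]]; split=> // i j k l ne.
have := on (i, j) (k, l); rewrite (negPf ne) cdot_tensor /= => /eqP.
by rewrite mulf_eq0 => /orP[] /eqP; [left | right].
Qed.

Lemma disjointC n (P Q : square R n) : disjoint_QLS P Q -> disjoint_QLS Q P.
Proof. by move=> [qP qQ PQ]; split=> // i j k l /PQ[]; [right | left]. Qed.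

Lemma disjoint_transpose n (P Q : square R n) :
  disjoint_QLS P Q -> disjoint_QLS (transpose P) (transpose Q).
Proof.
move=> [[Pr Pc] [Qr Qc] PQ]; split; [by split | by split | move=> i j k l ne].
by apply: PQ; rewrite xpair_eqE andbC -xpair_eqE.
Qed.

Section QLS.
Variables (n : nat) (P : square R n).
Hypothesis qP : is_QLS P.

Lemma QLS_row i j k : cdot (P i j) (P i k) = (j == k)%:R.
Proof. exact: (qP.1 i).1. Qed.

Lemma QLS_col i k j : cdot (P i j) (P k j) = (i == k)%:R.
Proof. exact: (qP.2 j).1. Qed.

Lemma QLS_unit i j : cdot (P i j) (P i j) = 1.
Proof. by rewrite QLS_row eqxx. Qed.

Lemma QLS_row0 i j k : j != k -> cdot (P i j) (P i k) = 0.
Proof. by rewrite QLS_row => /negPf ->. Qed.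

Lemma QLS_col0 i k j : i != k -> cdot (P i j) (P k j) = 0.
Proof. by rewrite QLS_col => /negPf ->. Qed.

Lemma weight_row0 i j k : j != k -> weight (P i j) (P i k) = 0.
Proof. by move=> jk; rewrite /weight QLS_row0 // sqnorm0. Qed.

Lemma weight_col0 i k j : i != k -> weight (P i j) (P k j) = 0.
Proof. by move=> jk; rewrite /weight QLS_col0 // sqnorm0. Qed.

Lemma weight_row_sum i j k : \sum_l weight (P i j) (P k l) = 1.
Proof. by apply: weight_sum; [apply: qP.1 | apply: QLS_unit]. Qed.

Lemma weight_col_sum i j l : \sum_k weight (P i j) (P k l) = 1.
Proof. by apply: weight_sum; [apply: qP.2 | apply: QLS_unit]. Qed.

Lemma weight_row_sum' i k l : \sum_j weight (P i j) (P k l) = 1.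
Proof. by under eq_bigr => j _ do rewrite weightC; apply: weight_row_sum. Qed.

(** Parseval writes the zero inner product of two entries of row [i] as a sum over row [i']; a
    nonzero term needs another one to cancel it. *)
Lemma QLS_quad i i' j j' k : j != j' ->
    0 < weight (P i j) (P i' k) -> 0 < weight (P i j') (P i' k) ->
  exists2 k', k' != k & 0 < weight (P i j) (P i' k') /\ 0 < weight (P i j') (P i' k').
Proof.
move=> jj' wj wj'.
have gt0 u v : (0 < @weight R n u v) = (cdot u v != 0).
  by rewrite lt_def weight_ge0 andbT weight_eq0.
pose F k' := cdot (P i j) (P i' k') * cdot (P i' k') (P i j').
have sF : \sum_k' F k' = 0 by rewrite -parseval ?QLS_row0 //; apply: qP.1.
have [/existsP[k' /andP[kk']]|] := boolP [exists k', (k' != k) && (F k' != 0)].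
  rewrite mulf_eq0 negb_or (cdotC (P i j')) conjC_eq0 => /andP[Fj Fj'].
  by exists k' => //; rewrite !gt0.
rewrite negb_exists => /forallP F0; exfalso.
move: sF; rewrite (bigD1 k) //= big1 => [|k' kk']; last first.
  by have := F0 k'; rewrite kk' negbK => /eqP.
rewrite addr0 => /eqP; rewrite mulf_eq0 (cdotC (P i j')) conjC_eq0.
by rewrite !gt0 in wj wj'; rewrite (negPf wj) (negPf wj').
Qed.

End QLS.

Lemma disjoint_weight n (P Q : square R n) i j k l : disjoint_QLS P Q ->
  (i, j) != (k, l) -> weight (P i j) (P k l) = 0 \/ weight (Q i j) (Q k l) = 0.
Proof.
by case=> _ _ PQ /PQ[]; rewrite /weight => ->; rewrite sqnorm0; [left | right].
Qed.

(** For [i = i'] the row is orthonormal. Otherwise the weights between the two rows satisfy the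
    hypotheses of [support_le2], the zero diagonals coming from the columns. *)
Lemma row_sparse (P Q : square R 5) i j i' :
  disjoint_QLS P Q -> sparse (P i') (P i j).
Proof.
move=> PQ p q s U; have [qP qQ _] := PQ.
have [<-|ii'] := eqVneq i i'.
  have [jp|/(weight_row0 qP) ->] := eqVneq j p; last by constructor 1.
  have jq : j != q by move: U => /= /andP[]; rewrite jp !inE negb_or => /andP[].
  by constructor 2; rewrite weight_row0.
pose x j k := weight (P i j) (P i' k); pose y j k := weight (Q i j) (Q i' k).
apply: (@support_le2 _ x y) => //; rewrite /x /y.
- by move=> *; apply: weight_ge0.
- by move=> *; apply: weight_ge0.
- by move=> *; apply: weight_row_sum.
- by move=> *; apply: weight_row_sum'.
- by move=> *; apply: weight_row_sum.
- by move=> *; apply: weight_row_sum'.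
- by move=> *; apply: weight_col0.
- by move=> *; apply: weight_col0.
- by move=> j' k'; apply: disjoint_weight => //; rewrite xpair_eqE (negPf ii').
- by move=> *; apply: QLS_quad.
Qed.

Lemma col_sparse (P Q : square R 5) i j j' :
  disjoint_QLS P Q -> sparse (P^~ j') (P i j).
Proof. by move/disjoint_transpose => PQ; apply: (row_sparse j i j' PQ). Qed.

(** The rows [m1], [m2], [m3] hold mass 3. Column [y] takes none of it, and column [y'] takes 1,
    since its cells in rows [x] and [x'] have weight 0. *)
Lemma outer_mass (Q : square R 5) x x' m1 m2 m3 y y' k1 k2 k3 : is_QLS Q ->
    uniq [:: x; x'; m1; m2; m3] -> uniq [:: y; y'; k1; k2; k3] ->
    weight (Q x y) (Q x' y') = 0 ->
  let z m k := weight (Q x y) (Q m k) in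
  z m1 k1 + z m1 k2 + z m1 k3 + (z m2 k1 + z m2 k2 + z m2 k3)
  + (z m3 k1 + z m3 k2 + z m3 k3) = 2.
Proof.
move=> qQ Ux Uy z0 z.
have r1 := weight_row_sum qQ x y m1; have r2 := weight_row_sum qQ x y m2.
have r3 := weight_row_sum qQ x y m3; have cy := weight_col_sum qQ x y y'.
rewrite (sum5 _ Uy) in r1; rewrite (sum5 _ Uy) in r2; rewrite (sum5 _ Uy) in r3.
rewrite (sum5 _ Ux) z0 in cy; move: r1 r2 r3 cy.
have yy' : y != y' by move: Uy => /= /andP[]; rewrite !inE !negb_or => /andP[].
rewrite weight_row0 //.
move: Ux => /= /andP[]; rewrite !inE !negb_or => /and4P[_ xm1 xm2 xm3] _.
rewrite !(weight_col0 qQ _ xm1) !(weight_col0 qQ _ xm2) !(weight_col0 qQ _ xm3) /z; lra.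
Qed.

(* The four block vectors of [Q] are orthonormal, and each has mass 2 on the
   nine outer cells; two of these cells carry no mass and the other seven at
   most 1 each, against a total of 8. *)
Lemma block_contradiction (P Q : square R 5) x1 x2 y1 y2 m k1 k2 :
    disjoint_QLS P Q -> x1 != x2 -> y1 != y2 -> m \notin [:: x1; x2] ->
    uniq [:: y1; y2; k1; k2] ->
    cdot (P x1 y1) (P x2 y2) != 0 -> cdot (P x1 y2) (P x2 y1) != 0 ->
    (forall x y k, x \in [:: x1; x2] -> y \in [:: y1; y2] -> k \in [:: k1; k2] ->
       cdot (P x y) (P m k) != 0) -> False.
Proof.
move=> PQ xx yy; rewrite !inE negb_or => /andP[mx1 mx2] Uk c12 c21 cm.
have [qP qQ _] := PQ.
have Q0 i j k l : i != k -> cdot (P i j) (P k l) != 0 -> cdot (Q i j) (Q k l) = 0.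
  have [_ _ dPQ] := PQ.
  by move=> ik; case: (dPQ i j k l) => [||//]; [rewrite xpair_eqE (negPf ik) | move=> ->; rewrite eqxx].
have [k3] : exists k3, k3 \notin [:: y1; y2; k1; k2] by apply: ord_fresh.
rewrite !inE !negb_or => /and4P[ky1 ky2 kk1 kk2].
move: Uk => /=; rewrite !inE !negb_or => /and4P[/and3P[_ y1k1 y1k2] /andP[y2k1 y2k2] k12 _].
have [m2] : exists m2, m2 \notin [:: x1; x2; m] by apply: ord_fresh.
rewrite !inE !negb_or => /and3P[m2x1 m2x2 m2m].
have [m3] : exists m3, m3 \notin [:: x1; x2; m; m2] by apply: ord_fresh.
rewrite !inE !negb_or => /and4P[m3x1 m3x2 m3m m3m2].
rewrite eq_sym in ky1; rewrite eq_sym in ky2; rewrite eq_sym in kk1; rewrite eq_sym in kk2.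
rewrite eq_sym in mx1; rewrite eq_sym in mx2; rewrite eq_sym in m2x1.
rewrite eq_sym in m2x2; rewrite eq_sym in m2m; rewrite eq_sym in m3x1.
rewrite eq_sym in m3x2; rewrite eq_sym in m3m; rewrite eq_sym in m3m2.
have Ux : uniq [:: x1; x2; m; m2; m3].
  by rewrite /= !inE !negb_or xx mx1 m2x1 m3x1 mx2 m2x2 m3x2 m2m m3m m3m2.
have Ux' : uniq [:: x2; x1; m; m2; m3].
  by rewrite /= !inE !negb_or eq_sym xx mx1 m2x1 m3x1 mx2 m2x2 m3x2 m2m m3m m3m2.
have Uy : uniq [:: y1; y2; k1; k2; k3].
  by rewrite /= !inE !negb_or yy y1k1 y1k2 ky1 y2k1 y2k2 ky2 k12 kk1 kk2.
have Uy' : uniq [:: y2; y1; k1; k2; k3].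
  by rewrite /= !inE !negb_or eq_sym yy y1k1 y1k2 ky1 y2k1 y2k2 ky2 k12 kk1 kk2.
(* Both diagonals of the block are non-orthogonal in [P], hence orthogonal in [Q]. *)
have q12 := Q0 _ _ _ _ xx c12; have q21 := Q0 _ _ _ _ xx c21.
have w12 : weight (Q x1 y1) (Q x2 y2) = 0 by rewrite /weight q12 sqnorm0.
have w21 : weight (Q x1 y2) (Q x2 y1) = 0 by rewrite /weight q21 sqnorm0.
have M11 := outer_mass qQ Ux Uy w12; have M12 := outer_mass qQ Ux Uy' w21.
rewrite weightC in w21; rewrite weightC in w12.
have M21 := outer_mass qQ Ux' Uy w21; have M22 := outer_mass qQ Ux' Uy' w12.
have B k l := weight_quadruple_le1 (QLS_unit qQ k l) (QLS_unit qQ x1 y1)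
  (QLS_unit qQ x1 y2) (QLS_unit qQ x2 y1) (QLS_unit qQ x2 y2)
  (QLS_row0 qQ _ yy) (QLS_col0 qQ _ xx) q12 q21 (QLS_col0 qQ _ xx) (QLS_row0 qQ _ yy).
have Z x y k : x \in [:: x1; x2] -> y \in [:: y1; y2] -> k \in [:: k1; k2] ->
    weight (Q x y) (Q m k) = 0.
  move=> hx hy hk; rewrite /weight Q0 ?sqnorm0 ?cm //.
  by move: hx; rewrite !inE => /orP[] /eqP ->.
have i1 (T : eqType) (a b : T) : a \in [:: a; b] by rewrite mem_head.
have i2 (T : eqType) (a b : T) : b \in [:: a; b] by rewrite !inE eqxx orbT.
move: M11 M12 M21 M22 => /=; rewrite !(Z _ _ k1) ?i1 ?i2 // !(Z _ _ k2) ?i1 ?i2 //.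
have := B m k3; have := B m2 k1; have := B m2 k2; have := B m2 k3.
have := B m3 k1; have := B m3 k2; have := B m3 k3; lra.
Qed.

End DisjointPairs.

(** * Exclusion of partial overlaps *)

Section Dichotomy.
Variable R : realType.

Lemma no_partial_overlap (P Q : square R 5) i j1 i' k1 : disjoint_QLS P Q ->
  0 < weight (P i j1) (P i' k1) -> weight (P i j1) (P i' k1) < 1 -> False.
Proof.
move=> PQ w0 w1; have [qP qQ _] := PQ.
have U1 := QLS_unit qP.
have sprs a b c : sparse (P c) (P a b) := row_sparse a b c PQ.
have [j2 j21 [be0 Ev]] : exists2 k, k != j1 &
    cdot (P i k) (P i' k1) != 0 /\
    P i' k1 = cdot (P i j1) (P i' k1) *: P i j1 + cdot (P i k) (P i' k1) *: P i k.
  by apply: sparse_two_terms => //; rewrite 1?weightC //; apply: qP.1.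
have [k2 k21 [de0 Eu]] : exists2 k, k != k1 &
    cdot (P i' k) (P i j1) != 0 /\
    P i j1 = cdot (P i' k1) (P i j1) *: P i' k1 + cdot (P i' k) (P i j1) *: P i' k.
  by apply: sparse_two_terms => //; apply: qP.1.
have al0 : cdot (P i j1) (P i' k1) != 0 by rewrite -weight_eq0 gt_eqF.
have ga0 : cdot (P i' k1) (P i j1) != 0 by rewrite -weight_eq0 weightC gt_eqF.
have gaal : cdot (P i' k1) (P i j1) * cdot (P i j1) (P i' k1) != 1.
  by rewrite -weightE -[1]/((1 : R)%:C%C) (inj_eq (@complexI R)) lt_eqF.
rewrite eq_sym in j21; rewrite eq_sym in k21.
set u := P i j1; set u' := P i j2.
have uu' : cdot u u' = 0 by apply: QLS_row0.
pose W a b := in_plane u u' (P a b); pose tau a b := weight u (P a b).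
(* A row or column with an entry not orthogonal to the plane has that entry and a second one inside
   the plane. *)
have lineR a b : weight u (P a b) + weight u' (P a b) != 0 ->
    W a b /\ exists2 c, c != b & W a c.
  by apply: (plane_line (f := P a) _ (U1 _ _) (U1 _ _) uu' Ev Eu) => //; apply: qP.1.
have lineC a b : weight u (P a b) + weight u' (P a b) != 0 ->
    W a b /\ exists2 c, c != a & W c b.
  by apply: (plane_line (f := P^~ b) _ (U1 _ _) (U1 _ _) uu' Ev Eu) => //;
    first [exact: qP.2 | move=> *; apply: (col_sparse _ _ _ PQ)].
have nz a b : W a b -> weight u (P a b) + weight u' (P a b) != 0.
  by rewrite /W /in_plane => ->; apply: oner_neq0.
(* Plane vectors whose [tau] do not sum to 1 are non-orthogonal, so distinct such cells share
   neither row nor column. This separates the indices below. *)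
have ortho a b c d : W a b -> W c d -> tau a b + tau c d <> 1 ->
    cdot (P a b) (P c d) != 0.
  by move=> Wa Wc ne; apply/eqP => /(in_plane_orthogonal (U1 i j1) (U1 i j2) (U1 _ _) (U1 _ _) Wa Wc).
have nrow a b c d : W a b -> W c d -> tau a b + tau c d <> 1 -> b != d -> a != c.
  move=> Wa Wc ne bd; have := ortho _ _ _ _ Wa Wc ne; apply: contraNneq => ac.
  by rewrite ac QLS_row0.
have ncol a b c d : W a b -> W c d -> tau a b + tau c d <> 1 -> a != c -> b != d.
  move=> Wa Wc ne bd; have := ortho _ _ _ _ Wa Wc ne; apply: contraNneq => ac.
  by rewrite ac QLS_col0.
have sumR a b d : W a b -> W a d -> b != d -> tau a b + tau a d = 1.
  by move=> Wa Wc bd; apply: in_plane_orthogonal Wa Wc _; rewrite ?U1 ?QLS_row0.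
have sumC a c b : W a b -> W c b -> a != c -> tau a b + tau c b = 1.
  by move=> Wa Wc bd; apply: in_plane_orthogonal Wa Wc _; rewrite ?U1 ?QLS_col0.
(* Plane cells reached from row [i] will have [tau] 0 or 1, those reached from row [i'] will have
   [lam] or [1 - lam]; two values of different kinds never sum to 1. *)
pose lam := tau i' k1; have lam0 : 0 < lam by []; have lam1 : lam < 1 by [].
have t1 : tau i j1 = 1 by rewrite /tau weight_self ?U1.
have t2 : tau i j2 = 0 by rewrite /tau weight_row0.
have W1 : W i j1.
  by rewrite /W /in_plane -/(tau i j1) t1 /u' weight_row0 1?eq_sym ?addr0.
have W2 : W i j2 by rewrite /W /in_plane -/(tau i j2) t2 /u' weight_self ?add0r ?U1.
have gt0_nz a b : 0 < tau a b -> weight u (P a b) + weight u' (P a b) != 0.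
  by move=> t0; rewrite gt_eqF // ltr_pwDl // weight_ge0.
have [W3 _] : W i' k1 /\ _ := lineR _ _ (gt0_nz _ _ w0).
have W4 : W i' k2.
  by apply: (lineR _ _ (gt0_nz _ _ _)).1; rewrite lt_def weight_ge0 andbT /tau weight_eq0 cdotC conjC_eq0.
have t3 : tau i' k1 = lam by [].
have t4 : tau i' k2 = 1 - lam by have := sumR _ _ _ W3 W4 k21; rewrite t3; lra.
have ii' : i != i'.
  apply/eqP => e; move: w0 w1; rewrite -e /weight QLS_row //.
  by case: eqP => _; rewrite ?sqnorm1 ?sqnorm0 ltxx.
(* From [(i, j1)] the path goes along its column to [(x, j1)], then along that row to [(x, j3)];
   likewise from [(i', k1)] through [(y, k1)] to [(y, k3)]. *)
have [_ [x xi Wx1]] := lineC _ _ (nz _ _ W1).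
have tx1 : tau x j1 = 0 by have := sumC _ _ _ W1 Wx1; rewrite eq_sym xi t1; lra.
have [_ [j3 j31 Wx3]] := lineR _ _ (nz _ _ Wx1).
rewrite eq_sym in j31; rewrite eq_sym in xi.
have tx3 : tau x j3 = 1 by have := sumR _ _ _ Wx1 Wx3 j31; rewrite tx1; lra.
have [_ [y yi' Wy1]] := lineC _ _ (nz _ _ W3).
have [_ [k3 k31 Wy3]] := lineR _ _ (nz _ _ Wy1).
rewrite eq_sym in k31; rewrite eq_sym in yi'.
have ty1 : tau y k1 = 1 - lam by have := sumC _ _ _ W3 Wy1 yi'; rewrite t3; lra.
have ty3 : tau y k3 = lam by have := sumR _ _ _ Wy1 Wy3 k31; rewrite ty1; lra.
have d11 : j1 != k1 by apply: ncol W1 W3 _ ii'; lra.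
have d12 : j1 != k2 by apply: ncol W1 W4 _ ii'; lra.
have d21 : j2 != k1 by apply: ncol W2 W3 _ ii'; lra.
have d22 : j2 != k2 by apply: ncol W2 W4 _ ii'; lra.
have xi' : x != i' by apply: nrow Wx1 W3 _ d11; lra.
have yi : i != y by apply: nrow W1 Wy1 _ d11; lra.
have xy : x != y by apply: nrow Wx1 Wy1 _ d11; lra.
(* If [j3 = j2], rows [i], [x] and columns [j1], [j2] close up to a block, with [i'] as the outer
   row. *)
have [j3E|j32] := eqVneq j3 j2.
  rewrite j3E in Wx3 tx3.
  apply: (block_contradiction (x1 := i) (x2 := x) (y1 := j1) (y2 := j2)
            (m := i') (k1 := k1) (k2 := k2) PQ) => //.
  - by rewrite !inE negb_or eq_sym ii' eq_sym xi'.
  - by rewrite /= !inE !negb_or j21 d11 d12 d21 d22 k21.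
  - by apply: ortho => //; lra.
  - by apply: ortho => //; lra.
  - by move=> a b c; rewrite !inE => /orP[] /eqP -> /orP[] /eqP -> /orP[] /eqP ->;
      apply: ortho => //; lra.
have j3k1 : k1 != j3 by rewrite eq_sym; apply: ncol Wx3 W3 _ xi'; lra.
have j3k2 : k2 != j3 by rewrite eq_sym; apply: ncol Wx3 W4 _ xi'; lra.
(* Now [j1], [j2], [k1], [k2], [j3] are all five columns, and [k3] avoids all but [k2]: the block
   closes in rows [i'], [y] instead. *)
have k3E : k3 = k2.
  have U : uniq [:: j1; j2; k1; k2; j3].
    by rewrite /= !inE !negb_or j21 d11 d12 d21 d22 k21 j31 (eq_sym j2) j32 j3k1 j3k2.
  have k3j1 : j1 != k3 by apply: ncol W1 Wy3 _ yi; lra.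
  have k3j2 : j2 != k3 by apply: ncol W2 Wy3 _ yi; lra.
  have k3j3 : j3 != k3 by apply: ncol Wx3 Wy3 _ xy; lra.
  by case: (ord5_cases k3 U) k3j1 k3j2 k3j3 k31 => [->|->|->|[]->]; rewrite ?eqxx.
rewrite k3E in Wy3 ty3.
apply: (block_contradiction (x1 := i') (x2 := y) (y1 := k1) (y2 := k2)
          (m := i) (k1 := j1) (k2 := j2) PQ) => //.
- by rewrite !inE negb_or ii' yi.
- by rewrite /= !inE !negb_or j21 !(eq_sym _ j1) !(eq_sym _ j2) d11 d12 d21 d22 k21.
(* The [tau] on a diagonal of this block may sum to 1, namely when [2 * lam = 1], so [ortho] does
   not apply. Both vectors are instead orthogonal to a third vector of the plane. *)
- apply: (in_plane_triple (U1 i j1) (U1 i j2) (U1 _ _) (U1 _ _) (U1 i' k2) W3 Wy3 W4).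
    exact: QLS_row0.
  by apply: QLS_col0; rewrite // eq_sym.
- apply: (in_plane_triple (U1 i j1) (U1 i j2) (U1 _ _) (U1 _ _) (U1 i' k1) W4 Wy1 W3).
    by apply: QLS_row0; rewrite // eq_sym.
  by apply: QLS_col0; rewrite // eq_sym.
- by move=> a b c; rewrite !inE => /orP[] /eqP -> /orP[] /eqP -> /orP[] /eqP ->;
    apply: ortho => //; lra.
Qed.

(** * From weights 0 and 1 to standard basis vectors *)

Lemma weight_dichotomy (P Q : square R 5) i j k l : disjoint_QLS P Q ->
  weight (P i j) (P k l) != 0 -> weight (P i j) (P k l) = 1.
Proof.
move=> PQ w0; have [qP _ _] := PQ.
have wgt0 : 0 < weight (P i j) (P k l) by rewrite lt_def w0 weight_ge0.
have [/(no_partial_overlap PQ wgt0) //|w1] := ltP (weight (P i j) (P k l)) 1.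
apply/le_anti; rewrite w1 andbT -(weight_row_sum qP i j k) (bigD1 l) //=.
by rewrite lerDl sumr_ge0 // => *; apply: weight_ge0.
Qed.

(** The weights against row [m] sum to 1, so one is nonzero, hence equal to 1, and the others
    vanish: the expansion in row [m] has a single term. *)
Lemma parallel_to_row (P Q : square R 5) i j m : disjoint_QLS P Q ->
  exists k (d : R[i]%C), `|d| = 1 /\ P i j = d *: P m k.
Proof.
move=> PQ; have [qP _ _] := PQ.
have [k wk] : exists k, weight (P i j) (P m k) != 0.
  apply/existsP; rewrite -negb_forall; apply/negP => /forallP w0.
  have := weight_row_sum qP i j m; rewrite big1 => [/eqP|k _]; last exact/eqP.
  by rewrite eq_sym oner_eq0.
have w1 := weight_dichotomy PQ wk.
exists k, (cdot (P m k) (P i j)); split.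
  apply/eqP; rewrite -(@pexpr_eq1 _ _ 2) // -sqnormE -/(weight _ _) weightC w1.
  by rewrite rmorph1.
rewrite {1}(onbasis_expand (P i j) (qP.1 m)) (bigD1 k) //= big1 ?addr0 // => l lk.
suff /eqP : weight (P i j) (P m l) = 0.
  by rewrite weightC weight_eq0 => /eqP ->; rewrite scale0r.
have := weight_row_sum qP i j m; rewrite (bigD1 k) //= w1 => /eqP.
rewrite -subr_eq0 addrAC subrr add0r psumr_eq0 => [/allP/(_ l)|*]; last exact: weight_ge0.
by rewrite mem_index_enum lk => /(_ isT)/eqP.
Qed.

Lemma onbasis_unitary n (f : 'I_n -> 'rV[R[i]%C]_n) : onbasis f ->
  exists2 U, unitary U & forall k, f k *m U = std_vec R k.
Proof.
move=> [on _]; pose M := \matrix_k f k.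
pose U := (map_mx (fun z : R[i]%C => z^*) M)^T.
have MU : M *m U = 1%:M.
  apply/matrixP => j k; rewrite !mxE eq_sym -on; apply: eq_bigr => l _.
  by rewrite !mxE mulrC.
exists U.
  rewrite /unitary (_ : (map_mx _ U)^T = M) ?(mulmx1C MU) //.
  apply/matrixP => j k; rewrite !mxE; exact: conjcK.
by move=> k; rewrite -[f k](rowK f) -row_mul MU rowE mulmx1.
Qed.

Lemma standard_form (P Q : square R 5) : disjoint_QLS P Q ->
  exists (c : 'I_5 -> 'I_5 -> R[i]%C) (U : 'M_5), [/\ forall i j, `|c i j| = 1, unitary U
    & forall i j, exists k, (c i j *: P i j) *m U = std_vec R k].
Proof.
move=> PQ; have [qP _ _] := PQ.
(* Row [0] is the reference: [U] carries it to the standard basis, and each entry of [P] is a phase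
   times one of its entries. *)
have [U uU fU] := onbasis_unitary (qP.1 0).
have ex_c (ij : 'I_5 * 'I_5) : exists c : R[i]%C, `|c| = 1 /\
    exists k, (c *: P ij.1 ij.2) *m U = std_vec R k.
  have [k [d [d1 ->]]] := parallel_to_row ij.1 ij.2 0 PQ.
  have d0 : d != 0 by rewrite -normr_eq0 d1 oner_neq0.
  exists d^-1; split; first by rewrite normfV d1 invr1.
  by exists k; rewrite scalerA mulVf // scale1r.
have [c cP] := fin_all_exists ex_c.
by exists (fun i j => c (i, j)), U; split=> // i j; have [] := cP (i, j).
Qed.

End Dichotomy.

Theorem mainTheorem4 (R : realType) (P Q : square R 5) :
  orthogonal_QLS P Q -> classical_pair P Q.
Proof.
move=> /orthogonal_disjoint PQ.
have [c [U [c1 uU cU]]] := standard_form PQ.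
have [d [V [d1 uV dV]]] := standard_form (disjointC PQ).
exists (fun i j => (c i j *: P i j) *m U), (fun i j => (d i j *: Q i j) *m V).
(* Two elementary isotopies: the phases, then the unitaries. *)
split=> //; apply: rt_trans; apply: rt_step; first exact: iso_phase c1 d1.
exact: iso_unitary uU uV.
Qed.
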